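(* Let $S_0,S_1,S_2$ be non-negative integers and $S:\{0,1,2\}^*\to\mathbb{N}$ the semigroup homomorphism with $S(i)=S_i$. Let $\mathbf t=T(\mathbf f)$. For $n\ge1$ put \[m(n)=\tfrac12\lfloor n\varphi\rfloor(S_0-2S_1+S_2)-\tfrac12 n(S_0-4S_1+S_2),\qquad \mu(n)=\big(n-1-\lfloor (n-1)\alpha\rfloor\big)\bmod 2,\] and $o_2=\tfrac12S_0-\tfrac12S_2$, $o_3=-\tfrac12S_0+\tfrac12S_2$, $e_1=S_0-S_1$, $e_2=-S_1+S_2$. Then for every $n\ge1$, $S(\mathcal L_{n,\mathbf t})=\{g_1(n),g_2(n),g_3(n)\}$, where \[g_1(n)=m(n)+e_1+o_3\mu(n),\quad g_2(n)=m(n)+e_2+(o_2-e_2)\mu(n),\quad g_3(n)=m(n)+o_3\mu(n).\]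
   Context: $\varphi=(1+\sqrt5)/2$, $\alpha=2-\varphi$, $\mathbf{f}=(\lfloor (n+1)\alpha\rfloor-\lfloor n\alpha\rfloor)_{n\ge1}$ (the Fibonacci word). $T$ keeps each $1$ and, among the occurrences of $0$ in order, replaces the 2nd, 4th, 6th, $\dots$ by $2$; so $\mathbf t=01201210210210120\cdots$. $\mathcal L_{n,\mathbf t}$ is the set of length-$n$ factors of $\mathbf t$, and $S(\mathcal L_{n,\mathbf t})=\{S(u):u\in\mathcal L_{n,\mathbf t}\}$, where $S(uv)=S(u)+S(v)$.
   Formalization: The formula for μ(n) is corrected to (n−1−⌊nα⌋) mod 2; as printed, with ⌊(n−1)α⌋, the claim fails at n=3, (S_0,S_1,S_2)=(1,0,0), where g_3(3)=1/2 is not an integer. *)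

(* Defs.v *)
From HB Require Import structures.
From mathcomp Require Import all_boot all_order all_algebra.
From mathcomp Require Import boolp classical_sets reals.
From mathcomp Require Import lra zify.

Set Implicit Arguments.
Unset Strict Implicit.
Unset Printing Implicit Defensive.

Import Order.TTheory GRing.Theory Num.Theory.

Local Open Scope classical_set_scope.
Local Open Scope ring_scope.

Definition phi (R : realType) : R := (1 + Num.sqrt 5) / 2.
Definition alpha (R : realType) : R := 2 - phi R.

(* Infinite words are functions on nat read from position 0, so that the letter
   at position k is the one with index k + 1 in the usual 1-based writing
   w_1 w_2 w_3 ... *)

Definition fib_diff (R : realType) (n : nat) : int :=
  Num.floor (n.+1%:R * alpha R) - Num.floor (n%:R * alpha R).

(* fib_diff R k.+1 is 0 or 1, so inord and the absolute value lose nothing: see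
   fibE below. *)
Definition fib (R : realType) (k : nat) : 'I_2 :=
  inord `|fib_diff R k.+1|%N.

Definition l0 : 'I_3 := @Ordinal 3 0 isT.
Definition l1 : 'I_3 := @Ordinal 3 1 isT.
Definition l2 : 'I_3 := @Ordinal 3 2 isT.

(* A 0 at position k is the j-th occurrence of 0, where j counts the zeros at
   positions 0, ..., k inclusive; it becomes 2 exactly when j is even. *)
Definition T (w : nat -> 'I_2) (k : nat) : 'I_3 :=
  if w k == 1%N :> nat then l1
  else if odd (count (fun j => w j == 0%N :> nat) (iota 0 k.+1)) then l0
  else l2.

Definition factors (A : Type) (n : nat) (w : nat -> A) : set (seq A) :=
  [set mkseq (fun j => w (i + j)%N) n | i in [set: nat]].

Section Values.
Context {R : realType}.

Definition m (S0 S1 S2 : R) (n : nat) : R :=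
  1 / 2 * (Num.floor (n%:R * phi R))%:~R * (S0 - 2 * S1 + S2)
  - 1 / 2 * n%:R * (S0 - 4 * S1 + S2).

(* n - 1 - floor(n alpha) is the number of 0s among the first n - 1 letters of
   the Fibonacci word.  The argument of the floor has to be n alpha: with
   (n - 1) alpha in its place the parity is wrong at n = 3, where g1, g2, g3
   would be half-integers for (S0, S1, S2) = (1, 0, 0). *)
Definition mu (n : nat) : R :=
  ((n%:Z - 1 - Num.floor (n%:R * alpha R)) %% 2)%Z%:~R.

Definition o2 (S0 S2 : R) : R := 1 / 2 * S0 - 1 / 2 * S2.
Definition o3 (S0 S2 : R) : R := - (1 / 2) * S0 + 1 / 2 * S2.
Definition e1 (S0 S1 : R) : R := S0 - S1.
Definition e2 (S1 S2 : R) : R := - S1 + S2.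

Definition g1 (S0 S1 S2 : R) (n : nat) : R :=
  m S0 S1 S2 n + e1 S0 S1 + o3 S0 S2 * mu n.
Definition g2 (S0 S1 S2 : R) (n : nat) : R :=
  m S0 S1 S2 n + e2 S1 S2 + (o2 S0 S2 - e2 S1 S2) * mu n.
Definition g3 (S0 S1 S2 : R) (n : nat) : R :=
  m S0 S1 S2 n + o3 S0 S2 * mu n.

End Values.

Lemma alpha_itv (R : realType) : 0 < alpha R < 1.
Proof.
rewrite /alpha /phi.
have h0 : 0 <= Num.sqrt (5 : R) by apply: sqrtr_ge0.
have h : Num.sqrt (5 : R) ^+ 2 = 5 by rewrite sqr_sqrtr.
apply/andP; split; nra.
Qed.

Lemma fibE (R : realType) (k : nat) :
  (fib R k : nat)%:Z = fib_diff R k.+1.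
Proof.
have /andP[a0 a1] := alpha_itv R.
rewrite /fib /fib_diff.
set x := k.+1%:R * alpha R.
have -> : k.+2%:R * alpha R = x + alpha R.
  by rewrite /x -[k.+2]addn1 natrD mulrDl mul1r.
have xle := floor_le x.
have xlt := floorD1_gt x.
have le1 : Num.floor x <= Num.floor (x + alpha R).
  by apply: le_floor; lra.
have le2 : Num.floor (x + alpha R) < Num.floor x + 2.
  rewrite floor_lt_int intrD.
  by move: xlt; rewrite intrD /=; lra.
by rewrite inordK; lia.
Qed.

(* Main.v *)
Require Import Defs.
From mathcomp Require Import all_boot all_order all_algebra.
From mathcomp Require Import boolp classical_sets reals.
From mathcomp Require Import ring lra zify.

Import Order.TTheory GRing.Theory Num.Theory.

Local Open Scope classical_set_scope.
Local Open Scope ring_scope.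

(** Let a = floor (n alpha) and j = i + 1. The number of 0s before position i of
    the Fibonacci word is j - 1 - floor (j alpha) = floor (j (1 - alpha)), and a
    factor of length n contains n - 1 - a or n - a zeros. As T alternates 0 and
    2, the weight of the factor at i depends only on its number of zeros and on
    the parity of the number of zeros before i; when the factor has an even
    number of zeros the parity is irrelevant, whence three values. Both data are
    read off j (1 - alpha) modulo 2, and all four combinations occur because
    these numbers are dense in [0, 2]. Density is explicit: odd powers of
    sqrt 5 - 2 are arbitrarily small numbers b sqrt 5 - a, and
    4 b (1 - alpha) = 2 (b sqrt 5 - a) modulo 2. *)

(** The exponent of 5 is even in [k ^ 2] and odd in [5 * n ^ 2]. *)
Lemma sqr_neq_5sqr (n k : nat) : (0 < n)%N -> (k ^ 2 <> 5 * n ^ 2)%N.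
Proof.
move=> n0 e; have k0 : (0 < k)%N by case: k e => //; case: n n0.
have : odd (logn 5 (k ^ 2)) by rewrite e lognM ?expn_gt0 ?n0 // lognX oddD oddM.
by rewrite lognX oddM.
Qed.

Lemma sqrt5_sqr (R : realType) : Num.sqrt (5 : R) ^+ 2 = 5.
Proof. by rewrite sqr_sqrtr. Qed.

(** The bounds are chosen so that [(sqrt 5 - 2) ^ 2 = 9 - 4 * sqrt 5] lies between 0 and 1/2. *)
Lemma sqrt5_itv (R : realType) : 17 / 8 < Num.sqrt (5 : R) < 9 / 4.
Proof.
have h0 : 0 <= Num.sqrt (5 : R) by exact: sqrtr_ge0.
have h := sqrt5_sqr R; apply/andP; split; nra.
Qed.

Lemma alpha_mul_neq_int (R : realType) (n : nat) (k : int) :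
  (0 < n)%N -> n%:R * alpha R <> k%:~R.
Proof.
move=> n0 e.
have e' : n%:R * Num.sqrt (5 : R) = (3 * n%:Z - 2 * k)%:~R.
  by rewrite intrB !intrM -e /alpha /phi -pmulrn; lra.
have e2 : (5 * n%:Z ^+ 2)%:~R = ((3 * n%:Z - 2 * k) ^+ 2)%:~R :> R.
  by rewrite !rmorphXn /= -e' exprMn sqrt5_sqr intrM rmorphXn /= -pmulrn mulrC.
move/intr_inj: e2 => e2.
have e3 : (`|(3 * n%:Z - 2 * k)%R| ^ 2 = 5 * n ^ 2)%N by nia.
exact: sqr_neq_5sqr n0 e3.
Qed.

Definition zeros (w : nat -> 'I_2) (k : nat) : nat :=
  count (fun j => w j == 0%N :> nat) (iota 0 k).

Lemma zerosS w k : zeros w k.+1 = (zeros w k + (w k == 0%N :> nat))%N.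
Proof. by rewrite /zeros -[k.+1]addn1 iotaD count_cat /= addn0. Qed.

(** Odd-numbered zeros stay [l0] and even-numbered ones become [l2]. The ones number
    [k - zeros w k]; the negative term is moved to the left to stay in [nat]. *)
Lemma hom_prefix (w : nat -> 'I_2) (S : seq 'I_3 -> nat)
    (S_hom : forall u v : seq 'I_3, S (u ++ v) = (S u + S v)%N) k :
  (S (mkseq (T w) k) + zeros w k * S [:: l1] =
   k * S [:: l1] + uphalf (zeros w k) * S [:: l0] + (zeros w k)./2 * S [:: l2])%N.
Proof.
elim: k => [|k IH].
  by have := S_hom [::] [::]; rewrite /zeros /mkseq /=; lia.
have Tk : T w k = if w k == 1%N :> nat then l1
    else if odd (zeros w k.+1) then l0 else l2 by [].
rewrite mkseqS -cats1 S_hom {}Tk zerosS.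
have := ltn_ord (w k).
case: (w k) => -[|[|//]] /= _ _; last by rewrite addn0; nia.
rewrite addn1 /= uphalf_half; move: IH; rewrite uphalf_half.
by case: (odd (zeros w k)) => /=; nia.
Qed.

Lemma hom_factor (w : nat -> 'I_2) (S : seq 'I_3 -> nat)
    (S_hom : forall u v : seq 'I_3, S (u ++ v) = (S u + S v)%N) i n :
  (S (mkseq (T w) i) + S (mkseq (fun j => T w (i + j)%N) n) =
   S (mkseq (T w) (i + n)))%N.
Proof.
rewrite -S_hom /mkseq iotaD map_cat add0n.
have -> : iota i n = [seq (i + j)%N | j <- iota 0 n] by rewrite -iotaDl addn0.
by rewrite -map_comp.
Qed.

(** The letters sum to a telescoping series whose initial term, the floor of [alpha], is 0. *)
Lemma zeros_fib (R : realType) k :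
  (zeros (fib R) k)%:Z = k%:Z - Num.floor (k.+1%:R * alpha R).
Proof.
elim: k => [|k IH].
  have /andP[a0 a1] := alpha_itv R.
  by rewrite /zeros /= mul1r (@floor_def _ _ 0) //= a1 ltW.
rewrite zerosS PoszD IH.
have := fibE R k; rewrite /fib_diff.
case: (fib R k) => -[|[|//]] /= _; lia.
Qed.

Lemma dense_mod2 (R : realType) (c d : R) : 0 <= c -> c < d ->
  exists (j : nat) (k : int),
    (0 < j)%N /\ c < j%:R * (1 - alpha R) - 2 * k%:~R < d.
Proof.
move=> c0 cd.
have /andP[s2 s9] := sqrt5_itv R; have ss := sqrt5_sqr R.
set s := Num.sqrt (5 : R) in s2 s9 ss.
have approx (k : nat) : exists a b : nat,
    [/\ (0 < b)%N, 0 < b%:R * s - a%:R :> R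
      & (b%:R * s - a%:R) * k.+1%:R <= 1 :> R].
  elim: k => [|k [a [b [b0 t0 t1]]]].
    by exists 2%N, 1%N; split => //; lra.
  (* multiply by (s - 2) ^+ 2 = 9 - 4 * s *)
  exists (9 * a + 20 * b)%N, (9 * b + 4 * a)%N.
  have -> : (9 * b + 4 * a)%N%:R * s - (9 * a + 20 * b)%N%:R
     = (9 - 4 * s) * (b%:R * s - a%:R).
    by ring: ss.
  split; [by lia| by apply: mulr_gt0 => //; lra |].
  have k0 : 0 <= k%:R :> R by [].
  move: t1; rewrite -[k.+2]addn2 -[k.+1]addn1 !natrD.
  move: (b%:R * s - a%:R) t0 => t t0 t1.
  (* Halving suffices for the induction because [(k + 2) / (k + 1) <= 2]. *)
  have h : 0 <= 9 - 4 * s <= 1 / 2 by apply/andP; split; lra.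
  move: (9 - 4 * s) h => v /andP[v0 v1].
  apply: (@le_trans _ _ (1 / 2 * t * (k%:R + 2))); last by nra.
  by apply: ler_wpM2r; [lra | apply: ler_wpM2r => //; exact: ltW].
have dc : 0 < d - c by lra.
have [a [b [b0 t0 t1]]] := approx (Num.bound (2 / (d - c))).
have tlt : 2 * (b%:R * s - a%:R) < d - c.
  have := archi_boundP (ltW (divr_gt0 (ltr0n R 2) dc)).
  rewrite ltr_pdivrMr // => hb.
  move: t1; rewrite -addn1 natrD.
  move: (Num.bound _)%:R hb => B; nra.
set t := 2 * (b%:R * s - a%:R) in tlt.
have tp : 0 < t by rewrite /t; lra.
have q0 : 0 <= c / t by rewrite divr_ge0 // ltW.
(* [N.+1 * t] is the first multiple of [t] above [c]; it exceeds [c] by at most [t < d - c]. *)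
have /andP[] := truncn_itv q0.
set N := Num.truncn (c / t).
rewrite ler_pdivlMr // ltr_pdivrMr // => l1' l2'.
exists (4 * b * N.+1)%N, (N.+1%:Z * (a%:Z - b%:Z)); split; first by lia.
have -> : (4 * b * N.+1)%N%:R * (1 - alpha R) - 2 * (N.+1%:Z * (a%:Z - b%:Z))%:~R
   = N.+1%:R * t.
  by rewrite intrM intrB -!pmulrn !natrM /alpha /phi -/s /t; field.
apply/andP; split; first exact: l2'.
by move: l1'; rewrite -addn1 natrD; lra.
Qed.

(** A prefix with p zeros has the correction [odd p / 2 * (S0 - S2)] to the mean weight of its
    zeros. Subtracting two prefixes cancels it for even [z]; otherwise its sign tells whether the
    first zero of the factor becomes [l0] or [l2]. *)
Lemma hom_value (R : realType) (w : nat -> 'I_2) (S : seq 'I_3 -> nat)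
    (S_hom : forall u v : seq 'I_3, S (u ++ v) = (S u + S v)%N) (i n z : nat) :
  zeros w (i + n) = (zeros w i + z)%N ->
  (S (mkseq (fun j => T w (i + j)%N) n))%:R =
    (n%:R - z%:R) * (S [:: l1])%:R
    + z%:R / 2 * ((S [:: l0])%:R + (S [:: l2])%:R)
    + (if odd z then (if odd (zeros w i) then -1 else 1) else 0) / 2
      * ((S [:: l0])%:R - (S [:: l2])%:R) :> R.
Proof.
move=> ez.
have cast k : (S (mkseq (T w) k))%:R = (k%:R - (zeros w k)%:R) * (S [:: l1])%:R
    + (zeros w k)%:R / 2 * ((S [:: l0])%:R + (S [:: l2])%:R)
    + (odd (zeros w k))%:R / 2 * ((S [:: l0])%:R - (S [:: l2])%:R) :> R.
  have := congr1 (fun q => q%:R : R) (hom_prefix w S S_hom k).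
  rewrite uphalf_half !natrD !natrM natrD => h.
  have := congr1 (fun q => q%:R : R) (odd_double_half (zeros w k)).
  rewrite -muln2 natrD natrM => <-.
  move: h; rewrite -{1}(odd_double_half (zeros w k)) -muln2 natrD natrM; lra.
have := congr1 (fun q => q%:R : R) (hom_factor w S S_hom i n).
rewrite natrD !cast ez oddD !natrD => /(canRL (addKr _)) ->.
by case: (odd z); case: (odd (zeros w i)) => /=; lra.
Qed.

(** A floor of a sum exceeds the sum of the floors by a carry of 0 or 1; [e] holds when there is no
    carry. *)
Lemma zeros_balanced (R : realType) (i n : nat) : (0 < n)%N ->
  exists e : bool, (zeros (fib R) (i + n))%:Z =
    (zeros (fib R) i)%:Z + (n%:Z - 1 - Num.floor (n%:R * alpha R)) + e%:Z.
Proof.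
move=> n0; rewrite !zeros_fib.
have -> : (i + n).+1%:R * alpha R = i.+1%:R * alpha R + n%:R * alpha R.
  by rewrite -addSn natrD mulrDl.
move: (i.+1%:R * _) (n%:R * _) => x y.
have [x1 x2] := (floor_le x, floorD1_gt x).
have [y1 y2] := (floor_le y, floorD1_gt y).
have [z1 z2] := (floor_le (x + y), floorD1_gt (x + y)).
rewrite !intrD /= in x2 y2 z2.
have h1 : Num.floor x + Num.floor y < Num.floor (x + y) + 1.
  by rewrite -(ltr_int R) !intrD /=; lra.
have h2 : Num.floor (x + y) < Num.floor x + Num.floor y + 2.
  by rewrite -(ltr_int R) !intrD /=; lra.
exists (Num.floor (x + y) == Num.floor x + Num.floor y).
case: eqP; lia.
Qed.

Lemma zeros_realized (R : realType) (n : nat) (b e : bool) : (0 < n)%N ->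
  exists i, odd (zeros (fib R) i) = b /\ (zeros (fib R) (i + n))%:Z =
    (zeros (fib R) i)%:Z + (n%:Z - 1 - Num.floor (n%:R * alpha R)) + e%:Z.
Proof.
move=> n0.
set a := Num.floor _; set t := n%:R * alpha R - a%:~R.
have t0 : 0 < t.
  rewrite subr_gt0 lt_neqAle floor_le andbT eq_sym.
  by apply/eqP; apply: alpha_mul_neq_int.
have t1 : t < 1.
  by have := floorD1_gt (n%:R * alpha R); rewrite intrD /= -/a /t; lra.
(* Modulo 2, the interval from [b] to [b + 1] fixes the parity. Its cut at [b + t] decides the
   carry: there is none exactly above the cut. Irrationality makes both pieces nonempty. *)
have [j [k [j0 /andP[l u]]]] : exists (j : nat) (k : int), (0 < j)%N /\
    b%:R + (if e then t else 0) < j%:R * (1 - alpha R) - 2 * k%:~R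
      < b%:R + (if e then 1 else t).
  apply: dense_mod2; first by rewrite addr_ge0 //; case: (e) => //; exact: ltW.
  by case: (e); lra.
case: j j0 l u => // i _ l u; exists i.
have fi : Num.floor (i.+1%:R * alpha R) = i%:Z - (2 * k + b%:Z).
  apply: floor_def; rewrite !(intrD, intrM, mulrNz) -!pmulrn -addn1 natrD.
  by move: l u; rewrite -addn1 natrD; case: (e); lra.
have fin : Num.floor ((i + n).+1%:R * alpha R)
    = i%:Z - (2 * k + b%:Z) + a + (~~ e)%:Z.
  apply: floor_def; rewrite !(intrD, intrM, mulrNz) -!pmulrn -addSn -addn1 !natrD.
  move: l u t0 t1; rewrite -addn1 natrD /t.
  by case: (e) => /=; move: (a%:~R) => A; lra.
have zi : (zeros (fib R) i)%:Z = 2 * k + b%:Z by rewrite zeros_fib fi; lia.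
split; first by case: (b) zi => zi; lia.
by rewrite zi zeros_fib fin; case: (e); lia.
Qed.

Theorem theorem17 (R : realType) (S0 S1 S2 : nat) (S : seq 'I_3 -> nat)
    (S_hom : forall u v : seq 'I_3, S (u ++ v) = (S u + S v)%N)
    (S_l0 : S [:: l0] = S0) (S_l1 : S [:: l1] = S1) (S_l2 : S [:: l2] = S2)
    (n : nat) (n_ge1 : (1 <= n)%N) :
  [set ((S u)%:R : R) | u in factors n (T (fib R))] =
  [set g1 S0%:R S1%:R S2%:R n; g2 S0%:R S1%:R S2%:R n;
       g3 S0%:R S1%:R S2%:R n].
Proof.
have [z hz] : exists z : nat, z%:Z = n%:Z - 1 - Num.floor (n%:R * alpha R).
  exists `|(n%:Z - 1 - Num.floor (n%:R * alpha R))%R|%N.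
  rewrite gez0_abs // subr_ge0 -ltzD1 subrK floor_lt_int -pmulrn.
  have /andP[_ a1] := alpha_itv R.
  by rewrite -[ltRHS]mulr1 ltr_pM2l // ltr0n.
(* As [phi = 2 - alpha] and [n * alpha] is not an integer, the floor is
   [2 * n - 1 - floor (n * alpha)]. *)
have hphi : Num.floor (n%:R * phi R) = n%:Z + z%:Z.
  have -> : n%:R * phi R = 2 * n%:R - n%:R * alpha R by rewrite /alpha; lra.
  have lo := floor_le (n%:R * alpha R).
  have hi := floorD1_gt (n%:R * alpha R).
  have ne := @alpha_mul_neq_int R n (Num.floor (n%:R * alpha R)) n_ge1.
  have lt : (Num.floor (n%:R * alpha R))%:~R < n%:R * alpha R.
    by rewrite lt_neqAle lo andbT eq_sym; apply/eqP.
  apply: floor_def; rewrite hz; move: hi lt; rewrite !(intrD, mulrNz) -!pmulrn.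
  by move: (_%:~R) => A; lra.
have hmu : mu n = (odd z)%:R :> R by rewrite /mu -hz modz_nat modn2 -pmulrn.
(* Weight of a factor with [z + e] zeros, where [b] says that the zeros before it are odd in number;
   [b] is irrelevant when [z + e] is even. *)
pose value (b e : bool) : R :=
  if odd z then if e then g1 S0%:R S1%:R S2%:R n else
                if b then g3 S0%:R S1%:R S2%:R n else g2 S0%:R S1%:R S2%:R n
  else if ~~ e then g3 S0%:R S1%:R S2%:R n else
       if b then g2 S0%:R S1%:R S2%:R n else g1 S0%:R S1%:R S2%:R n.
have valueE i (e : bool) : (zeros (fib R) (i + n))%:Z =
      (zeros (fib R) i)%:Z + (n%:Z - 1 - Num.floor (n%:R * alpha R)) + e%:Z ->
    (S (mkseq (fun j => T (fib R) (i + j)%N) n))%:R =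
      value (odd (zeros (fib R) i)) e.
  move=> ei; have {}ei : zeros (fib R) (i + n) = (zeros (fib R) i + (z + e))%N.
    by lia.
  rewrite (hom_value R (fib R) S S_hom i n (z + e) ei).
  rewrite S_l0 S_l1 S_l2 /value /g1 /g2 /g3 /m hmu hphi /o2 /o3 /e1 /e2.
  rewrite intrD natrD -!pmulrn oddD oddb.
  by case: (odd z); case: (e); case: (odd (zeros (fib R) i)) => /=; lra.
apply/seteqP; split => x /=.
  case=> _ [i _ <-] <-.
  have [e /valueE ->] := zeros_balanced R i n n_ge1.
  rewrite /value.
  by case: (odd z); case: (e); case: (odd _); rewrite /=; tauto.
have attained (b e : bool) :
    exists2 u, factors n (T (fib R)) u & (S u)%:R = value b e.
  have [i [<- /valueE vi]] := zeros_realized R n b e n_ge1.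
  by exists (mkseq (fun j => T (fib R) (i + j)%N) n); first by exists i.
rewrite /value in attained.
case=> [[->|->]|->]; case: (odd z) attained => A.
(* The goals are [g1], [g2], [g3], each for [z] odd, then even. *)
- exact: A true true.
- exact: A false true.
- exact: A false false.
- exact: A true true.
- exact: A true false.
- exact: A true false.
Qed.
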